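(* $$\sum_{k=0}^{\infty}\frac{\binom{2k}{k}^4\binom{3k}{k}}{2^{12k}}\Big\{(74k^2+27k+3)(51H_{3k}+250H_{2k}-153H_k)+15\Big\}=\frac{9792\log 2}{\pi^2}.$$
   Context: For a nonnegative integer $n$, $H_n=\sum_{j=1}^{n}\frac{1}{j}$ denotes the classical harmonic number, with $H_0=0$. $\log$ is the natural logarithm. *)

(* Defs.v *)
From Stdlib Require Import Reals.
From Coquelicot Require Import Coquelicot.
Open Scope R_scope.

(* [sum_n_m a 1 0] is the empty sum, so [harmonic 0 = 0]. *)
Definition harmonic (n : nat) : R := sum_n_m (fun j : nat => / INR j) 1 n.

(* Main.v *)
Require Import Defs.
From Stdlib Require Import Reals Lra Lia Psatz Factorial.
From Coquelicot Require Import Coquelicot.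
Open Scope R_scope.

(** The series is the first-order part of a two-parameter deformation of
    Guillera's series, the sum of the same hypergeometric terms times
    74 n^2 + 27 n + 3, whose value is 48 / PI^2.

    Replace the summand by a function [wzG a b n m] of two real parameters and
    of a shift [m] that adds [m] to both parameters.  It has a companion [wzH]
    with [wzH a b 0 m = 0] and
      [wzG a b n (S m) - wzG a b n m = wzH a b (S n) m - wzH a b n m]
    ([wz_relation]), so that the sum of [wzG] over [n] does not depend on [m].
    As [m] grows, every term with [n > 0] dies and the sum is the limit of
    [wzG a b 0 m], which is a quotient of products of Wallis type.

    The pair comes from Dougall's very-well-poised 5F4 series with parameters
    (A; B, C, D, E) = (1/2 + a; 1/2 + a, 1/2, 1/2, a + b).  Once its
    term is normalised by the sum, the change of the term under an integer shift
    of the parameters telescopes in the summation index; for the shifts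
    (1; 1, 0, 0, 1), (1; 0, 1, 0, 1), (1; 0, 0, 1, 1) and (0; 0, 0, 0, 1) the
    certificate at index 0 is a single product.  Going from [n] to [n + 1] is the
    composition of the first three, whence the three summands of [factorG];
    going from [m] to [m + 1] is the composition of the first and the last,
    whence the two of [factorH].

    The parameters move along the line (a, b) = (125 x, - 74 x).  There the
    logarithmic derivative at x = 0 of the hypergeometric factor is
    51 H_{3n} + 250 H_{2n} - 153 H_n, while [factorG], of value
    (74 n^2 + 27 n + 3) / 48, has derivative 15 / 48, so that the summand of the
    theorem is 48 times the derivative [wzG' n 0] ([summand_eq]).  On the other
    side the limit of [wzG] at n = 0 is 1 / PI^2 and its logarithmic derivative
    is 204 times the limit ln 2 of H_{2m} - H_m ([wzG'_row0_lim]).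

    No derivative is exchanged with an infinite sum: the relation between
    [wzG] and [wzH] is differentiated at x = 0 ([wz_relation']), summed over
    n <= N and over m < N, and the two error terms are controlled by the
    geometric decay of the hypergeometric factor in [n], uniform in [m]
    ([weight_le]). *)

(** * The two-parameter pair *)

Fixpoint rising (c : R) (k : nat) : R :=
  match k with O => 1 | S k' => rising c k' * (c + INR k') end.

Lemma rising_pos c k : 0 < c -> 0 < rising c k.
Proof.
  intros Hc; induction k as [|k IH]; simpl; [lra|].
  apply Rmult_lt_0_compat; [exact IH|]. pose proof (pos_INR k); lra.
Qed.

(** The factor [rising (1/2 + b) m ^ 2], and [m + n] in place of [n] in the
    indices, normalise Dougall's term so that the sum over [n] is independent
    of [m]; at a = b = m = 0 this is the binomial factor of the series. *)
Definition weight (a b : R) (n m : nat) : R :=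
  rising (1/2 + a) (m + n) ^ 2 * rising (1/2 + b) m ^ 2 * rising (1/2) n ^ 4
  * rising (1 + a + b) (2 * m + 3 * n)
  / (rising 1 (2 * n) * rising (1 + a) (m + 2 * n) ^ 2
     * rising (1 + a + b) (2 * m + n) * rising (1 + b) (m + n) ^ 2).

Definition ratio_n (A B n : R) : R :=
  (1/2 + A + n) ^ 2 * (1/2 + n) ^ 4
  * ((1 + A + B + 3 * n) * (2 + A + B + 3 * n) * (3 + A + B + 3 * n))
  / ((1 + 2 * n) * (2 + 2 * n) * (1 + A + 2 * n) ^ 2 * (2 + A + 2 * n) ^ 2
     * (1 + A + B + n) * (1 + B + n) ^ 2).

Definition ratio_m (A B n : R) : R :=
  (1/2 + A + n) ^ 2 * (1/2 + B) ^ 2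
  * ((1 + A + B + 3 * n) * (2 + A + B + 3 * n))
  / ((1 + A + 2 * n) ^ 2 * ((1 + A + B + n) * (2 + A + B + n))
     * (1 + B + n) ^ 2).

(** At [n = 0] and [A + B = 0] the first quotient is a division by zero, which
    is harmless because of the factor [2 * n]. *)
Definition factorG (A B n : R) : R :=
  2 * n * ((B + n) ^ 2 / (A + B + 3 * n))
  + (1/2 + A + n) ^ 2 * (B + n) / (1 + A + 2 * n)
  + (1/2 + A + n) ^ 2 * (1/2 + n) * (1 + A + B + 3 * n)
    / (2 * (1 + A + 2 * n) ^ 2).

Definition factorH (A B n : R) : R :=
  2 * n * ((B + n) ^ 2 / (A + B + 3 * n)
           + (1/2 + A + n) ^ 2 / (A + B + n + 1)).

(** The relation between [wzG] and [wzH] divided by [weight]: since [a], [b] and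
    [m] enter the ratios of [weight] only through [A = a + m] and [B = b + m],
    it is an identity of rational functions in three variables.  The case
    [n = 0] is apart because [A + B + 3 * n] may vanish there. *)
Lemma factorG_step A B n :
  -1/2 < A -> -1/2 < B -> n = 0 \/ 1 <= n ->
  ratio_m A B n * factorG (A + 1) (B + 1) n - factorG A B n
  = ratio_n A B n * factorH A B (n + 1) - factorH A B n.
Proof.
  intros HA HB [-> | Hn]; unfold ratio_m, ratio_n, factorG, factorH.
  - rewrite !Rmult_0_r, !Rmult_0_l. field. repeat split; lra.
  - field. repeat split; lra.
Qed.

Lemma weight_succ_n a b n m :
  -1/2 < a -> -1/2 < b ->
  weight a b (S n) m = ratio_n (a + INR m) (b + INR m) (INR n) * weight a b n m.
Proof.
  intros Ha Hb; unfold weight, ratio_n.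
  replace (m + S n)%nat with (S (m + n)) by lia.
  replace (2 * m + 3 * S n)%nat with (S (S (S (2 * m + 3 * n)))) by lia.
  replace (2 * S n)%nat with (S (S (2 * n))) by lia.
  replace (m + S (S (2 * n)))%nat with (S (S (m + 2 * n))) by lia.
  replace (2 * m + S n)%nat with (S (2 * m + n)) by lia.
  cbn [rising]; rewrite !S_INR, !plus_INR, !mult_INR; simpl (INR 2); simpl (INR 3).
  pose proof (pos_INR n); pose proof (pos_INR m).
  field.
  repeat split; try lra; apply Rgt_not_eq, rising_pos; lra.
Qed.

Lemma weight_succ_m a b n m :
  -1/2 < a -> -1/2 < b ->
  weight a b n (S m) = ratio_m (a + INR m) (b + INR m) (INR n) * weight a b n m.
Proof.
  intros Ha Hb; unfold weight, ratio_m.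
  replace (2 * S m)%nat with (S (S (2 * m))) by lia.
  replace (S m + n)%nat with (S (m + n)) by lia.
  replace (S m + 2 * n)%nat with (S (m + 2 * n)) by lia.
  replace (S (S (2 * m)) + 3 * n)%nat with (S (S (2 * m + 3 * n))) by lia.
  replace (S (S (2 * m)) + n)%nat with (S (S (2 * m + n))) by lia.
  cbn [rising]; rewrite !S_INR, !plus_INR, !mult_INR; simpl (INR 2); simpl (INR 3).
  pose proof (pos_INR n); pose proof (pos_INR m).
  field.
  repeat split; try lra; apply Rgt_not_eq, rising_pos; lra.
Qed.

Definition wzG (a b : R) (n m : nat) : R :=
  weight a b n m * factorG (a + INR m) (b + INR m) (INR n).
Definition wzH (a b : R) (n m : nat) : R :=
  weight a b n m * factorH (a + INR m) (b + INR m) (INR n).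

Lemma wz_relation a b n m :
  -1/2 < a -> -1/2 < b ->
  wzG a b n (S m) - wzG a b n m = wzH a b (S n) m - wzH a b n m.
Proof.
  intros Ha Hb; unfold wzG, wzH.
  rewrite weight_succ_n, weight_succ_m by assumption.
  rewrite !S_INR, <- !Rplus_assoc.
  assert (Hn : INR n = 0 \/ 1 <= INR n).
  { destruct n; [left; reflexivity|right].
    rewrite S_INR; pose proof (pos_INR n); lra. }
  pose proof (pos_INR m).
  pose proof (factorG_step (a + INR m) (b + INR m) (INR n)
                ltac:(lra) ltac:(lra) Hn) as E.
  transitivity (weight a b n m *
    (ratio_m (a + INR m) (b + INR m) (INR n)
       * factorG (a + INR m + 1) (b + INR m + 1) (INR n)
     - factorG (a + INR m) (b + INR m) (INR n))); [ring|].
  rewrite E; ring.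
Qed.

(** * Differentiation along a line of parameters *)

Fixpoint recip_sum (c : R) (k : nat) : R :=
  match k with O => 0 | S k' => recip_sum c k' + / (c + INR k') end.

Lemma is_derive_rising c t k :
  0 < c ->
  is_derive (fun x => rising (c + t * x) k) 0 (rising c k * (t * recip_sum c k)).
Proof.
  intros Hc; induction k as [|k IH]; simpl.
  - replace (1 * (t * 0)) with 0 by ring. apply @is_derive_const.
  - pose proof (pos_INR k).
    evar_last.
    + apply (is_derive_mult (fun x => rising (c + t * x) k) (fun x => c + t * x + INR k)).
      * exact IH.
      * auto_derive; [exact I|reflexivity].
      * intros; apply Rmult_comm.
    + unfold plus, mult; simpl. rewrite !Rmult_0_r, Rplus_0_r. field. lra.
Qed.

(** Equalities typed in one of the algebraic structures on [R] are restated in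
    [R] itself, where [ring] applies. *)
Ltac R_eq := cbv beta; match goal with |- ?a = ?b => change (@eq R a b) end.

(** Products of rising factorials are best differentiated through their
    logarithmic derivative [l], which is additive. *)
Definition log_derive (f : R -> R) (l : R) : Prop := is_derive f 0 (f 0 * l).

Lemma log_derive_rising c t k :
  0 < c -> log_derive (fun x => rising (c + t * x) k) (t * recip_sum c k).
Proof.
  intros Hc; unfold log_derive. rewrite Rmult_0_r, Rplus_0_r.
  apply is_derive_rising, Hc.
Qed.

Lemma log_derive_const c : log_derive (fun _ => c) 0.
Proof. unfold log_derive. rewrite Rmult_0_r. apply @is_derive_const. Qed.

Lemma log_derive_mult f g l k :
  log_derive f l -> log_derive g k -> log_derive (fun x => f x * g x) (l + k).
Proof.
  unfold log_derive; intros Hf Hg. evar_last.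
  - apply (is_derive_mult f g 0 _ _ Hf Hg). intros; apply Rmult_comm.
  - unfold plus, mult; simpl; ring.
Qed.

Lemma log_derive_sqr f l : log_derive f l -> log_derive (fun x => f x ^ 2) (2 * l).
Proof.
  intros Hf. pose proof (log_derive_mult _ _ _ _ Hf Hf) as H.
  unfold log_derive in *. replace (f 0 ^ 2 * (2 * l)) with (f 0 * f 0 * (l + l)) by ring.
  apply (is_derive_ext (fun x => f x * f x)); [intros; simpl; ring|exact H].
Qed.

Lemma log_derive_div f g l k :
  g 0 <> 0 -> log_derive f l -> log_derive g k -> log_derive (fun x => f x / g x) (l - k).
Proof.
  unfold log_derive; intros H0 Hf Hg. evar_last.
  - apply (is_derive_div f g 0 _ _ Hf Hg H0).
  - unfold minus, plus, opp, mult; simpl. field. exact H0.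
Qed.

Definition weight_log (n m : nat) : R :=
  250 * recip_sum (1/2) (m + n) - 148 * recip_sum (1/2) m
  + 51 * recip_sum 1 (2 * m + 3 * n) - 250 * recip_sum 1 (m + 2 * n)
  - 51 * recip_sum 1 (2 * m + n) + 148 * recip_sum 1 (m + n).

(** Along the line, 1 + a + b = 1 + 51 x, so every factor is a rising factorial
    based at an affine function of x. *)
Lemma log_derive_weight n m :
  log_derive (fun x => weight (125 * x) (- 74 * x) n m) (weight_log n m).
Proof.
  unfold weight.
  assert (E : forall c k x, rising (c + 125 * x + - 74 * x) k = rising (c + 51 * x) k)
    by (intros; f_equal; ring).
  unfold log_derive.
  apply (is_derive_ext (fun x =>
   rising (1/2 + 125 * x) (m + n) ^ 2 * rising (1/2 + - 74 * x) m ^ 2 * rising (1/2) n ^ 4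
  * rising (1 + 51 * x) (2 * m + 3 * n)
  / (rising 1 (2 * n) * rising (1 + 125 * x) (m + 2 * n) ^ 2
     * rising (1 + 51 * x) (2 * m + n) * rising (1 + - 74 * x) (m + n) ^ 2))).
  { intros x. now rewrite !E. }
  rewrite !E. evar_last.
  - apply log_derive_div.
    2: repeat apply log_derive_mult; try apply log_derive_sqr;
       try (apply log_derive_rising; lra); apply log_derive_const.
    2: repeat apply log_derive_mult; try apply log_derive_sqr;
       try (apply log_derive_rising; lra); apply log_derive_const.
    rewrite !Rmult_0_r, !Rplus_0_r.
    repeat first [ apply pow_nonzero | apply Rgt_not_eq, rising_pos; lra
                 | apply Rmult_integral_contrapositive_currified ].
  - cbv beta. f_equal. unfold weight_log. ring.
Qed.

Definition factorG' (n m : R) : R :=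
  let u := (m + n) / (2 * m + 3 * n) in
  let v := (1/2 + m + n) / (1 + m + 2 * n) in
  let y := (1 + 2 * m + 3 * n) / (1 + m + 2 * n) in
  2 * n * (- 148 * u - 51 * u ^ 2)
  + (250 * v * (m + n) - 74 * v * (1/2 + m + n) - 125 * v ^ 2 * (m + n))
  + (1/2 + n) / 2 * (250 * v * y + 51 * v ^ 2 - 250 * v ^ 2 * y).

Definition factorH' (n m : R) : R :=
  let u := (m + n) / (2 * m + 3 * n) in
  let z := (1/2 + m + n) / (1 + 2 * m + n) in
  2 * n * (- 148 * u - 51 * u ^ 2 + 250 * z - 51 * z ^ 2).

Lemma is_derive_factorG n m :
  n = 0 \/ 1 <= n -> 0 <= m ->
  is_derive (fun x => factorG (125 * x + m) (- 74 * x + m) n) 0 (factorG' n m).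
Proof.
  intros [-> | Hn] Hm; unfold factorG, factorG'; cbv zeta.
  - apply (is_derive_ext (fun x =>
      (1/2 + (125 * x + m) + 0) ^ 2 * (- 74 * x + m + 0) / (1 + (125 * x + m) + 2 * 0)
      + (1/2 + (125 * x + m) + 0) ^ 2 * (1/2 + 0)
        * (1 + (125 * x + m) + (- 74 * x + m) + 3 * 0)
        / (2 * (1 + (125 * x + m) + 2 * 0) ^ 2))).
    { intros x. rewrite !Rmult_0_r, !Rmult_0_l. R_eq; ring. }
    rewrite !Rmult_0_r, !Rmult_0_l. auto_derive.
    + repeat split; try lra. apply Rmult_integral_contrapositive_currified; nra.
    + field. lra.
  - auto_derive.
    + repeat split; try lra. apply Rmult_integral_contrapositive_currified; nra.
    + field. lra.
Qed.

Lemma is_derive_factorH n m :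
  n = 0 \/ 1 <= n -> 0 <= m ->
  is_derive (fun x => factorH (125 * x + m) (- 74 * x + m) n) 0 (factorH' n m).
Proof.
  intros [-> | Hn] Hm; unfold factorH, factorH'; cbv zeta.
  - apply (is_derive_ext (fun x => 0)).
    { intros x. rewrite !Rmult_0_r, !Rmult_0_l. R_eq; ring. }
    rewrite Rmult_0_r, Rmult_0_l. apply @is_derive_const.
  - auto_derive.
    + repeat split; lra.
    + field. lra.
Qed.

(** The derivatives of [wzG] and [wzH] at x = 0 along (125 x, - 74 x); the weight
    is differentiated logarithmically. *)
Definition wzG' (n m : nat) : R :=
  weight 0 0 n m * (weight_log n m * factorG (INR m) (INR m) (INR n)
                    + factorG' (INR n) (INR m)).
Definition wzH' (n m : nat) : R :=
  weight 0 0 n m * (weight_log n m * factorH (INR m) (INR m) (INR n)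
                    + factorH' (INR n) (INR m)).

Lemma INR_0_or_ge_1 n : INR n = 0 \/ 1 <= INR n.
Proof.
  destruct n; [left; reflexivity|right].
  rewrite S_INR; pose proof (pos_INR n); lra.
Qed.

Lemma is_derive_mult_log f g l dg :
  log_derive f l -> is_derive g 0 dg ->
  is_derive (fun x => f x * g x) 0 (f 0 * (l * g 0 + dg)).
Proof.
  unfold log_derive; intros Hf Hg. evar_last.
  - apply (is_derive_mult f g 0 _ _ Hf Hg). intros; apply Rmult_comm.
  - unfold plus, mult; simpl; ring.
Qed.

Lemma is_derive_wzG n m :
  is_derive (fun x => wzG (125 * x) (- 74 * x) n m) 0 (wzG' n m).
Proof.
  evar_last.
  - apply (is_derive_mult_log _ _ _ _ (log_derive_weight n m)
            (is_derive_factorG _ _ (INR_0_or_ge_1 n) (pos_INR m))).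
  - cbv beta. now rewrite !Rmult_0_r, !Rplus_0_l.
Qed.

Lemma is_derive_wzH n m :
  is_derive (fun x => wzH (125 * x) (- 74 * x) n m) 0 (wzH' n m).
Proof.
  evar_last.
  - apply (is_derive_mult_log _ _ _ _ (log_derive_weight n m)
            (is_derive_factorH _ _ (INR_0_or_ge_1 n) (pos_INR m))).
  - cbv beta. now rewrite !Rmult_0_r, !Rplus_0_l.
Qed.

(** Both sides of [wz_relation] agree as functions of x near 0, hence have the
    same derivative there. *)
Lemma wz_relation' n m :
  wzG' n (S m) - wzG' n m = wzH' (S n) m - wzH' n m.
Proof.
  pose proof (is_derive_minus _ _ _ _ _ (is_derive_wzG n (S m)) (is_derive_wzG n m)) as HG.
  pose proof (is_derive_minus _ _ _ _ _ (is_derive_wzH (S n) m) (is_derive_wzH n m)) as HH.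
  apply is_derive_unique in HG; apply is_derive_unique in HH.
  etransitivity; [symmetry; exact HG|]; etransitivity; [|exact HH].
  apply Derive_ext_loc.
  (* 125 |x| < 1/2 keeps both parameters above - 1/2 *)
  exists (mkposreal (1/250) ltac:(lra)); intros x Hx.
  assert (H : Rabs x < 1/250).
  { replace x with (x - 0) by ring. exact Hx. }
  apply Rabs_def2 in H.
  apply wz_relation; lra.
Qed.

(** * Bounds on the rational factors *)

Lemma recip_sum_bounds c k : 0 < c -> 0 <= recip_sum c k <= / c * INR k.
Proof.
  intros Hc; induction k as [|k IH]; [simpl; lra|].
  cbn [recip_sum]; rewrite S_INR. pose proof (pos_INR k).
  assert (0 < / (c + INR k)) by (apply Rinv_0_lt_compat; lra).
  assert (/ (c + INR k) <= / c) by (apply Rinv_le_contravar; lra).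
  lra.
Qed.

Lemma weight_log_bound n m :
  Rabs (weight_log n m) <= 1400 * (INR m + INR n + 1).
Proof.
  unfold weight_log.
  pose proof (recip_sum_bounds (1/2) (m + n) ltac:(lra)) as H1.
  pose proof (recip_sum_bounds (1/2) m ltac:(lra)) as H2.
  pose proof (recip_sum_bounds 1 (2 * m + 3 * n) ltac:(lra)) as H3.
  pose proof (recip_sum_bounds 1 (m + 2 * n) ltac:(lra)) as H4.
  pose proof (recip_sum_bounds 1 (2 * m + n) ltac:(lra)) as H5.
  pose proof (recip_sum_bounds 1 (m + n) ltac:(lra)) as H6.
  rewrite ?plus_INR, ?mult_INR in *; simpl (INR 2) in *; simpl (INR 3) in *.
  replace (/ (1/2)) with 2 in * by field. rewrite Rinv_1 in *.
  pose proof (pos_INR n); pose proof (pos_INR m).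
  apply Rabs_le; lra.
Qed.

Lemma Rdiv_unit p q : 0 <= p -> p <= q -> 0 < q -> 0 <= p / q <= 1.
Proof.
  intros Hp Hpq Hq; split.
  - apply Rdiv_le_0_compat; lra.
  - apply Rle_div_l; lra.
Qed.

Lemma Rabs_add_le x y X Y : Rabs x <= X -> Rabs y <= Y -> Rabs (x + y) <= X + Y.
Proof. intros; eapply Rle_trans; [apply Rabs_triang|lra]. Qed.

Lemma Rabs_mul_le x y X Y : Rabs x <= X -> Rabs y <= Y -> Rabs (x * y) <= X * Y.
Proof. intros; rewrite Rabs_mult; apply Rmult_le_compat; auto using Rabs_pos. Qed.

(** The quotient with denominator [2 * m + 3 * n] has no usable bound at
    [n = m = 0]; the factor [2 * n] in front makes one unnecessary. *)
Lemma n_mul_bound n m q K :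
  0 <= n -> 0 <= m -> 0 <= K -> (n <> 0 -> Rabs q <= K) ->
  Rabs (2 * n * q) <= 2 * (m + n + 1) * K.
Proof.
  intros Hn Hm HK Hq. destruct (Req_dec n 0) as [E|E].
  - rewrite E, Rmult_0_r, Rmult_0_l, Rabs_R0.
    apply Rmult_le_pos; lra.
  - apply Rabs_mul_le; [|auto]. apply Rabs_le; lra.
Qed.

(** Written with the quotients [u = (m + n) / (2 * m + 3 * n)] and
    [v = (1/2 + m + n) / (1 + m + 2 * n)], both in [0, 1], the rational factors
    become polynomials of degree at most 2 in [m] and [n]. *)
Lemma factorG_bound n m :
  n = 0 \/ 1 <= n -> 0 <= m -> Rabs (factorG m m n) <= 5 * (m + n + 1) ^ 2.
Proof.
  intros Hn Hm. set (s := m + n + 1).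
  unfold factorG.
  pose proof (Rdiv_unit (1/2 + m + n) (1 + m + 2 * n) ltac:(lra) ltac:(lra) ltac:(lra)) as Hv.
  replace ((1/2 + m + n) ^ 2 * (m + n) / (1 + m + 2 * n))
    with ((1/2 + m + n) / (1 + m + 2 * n) * ((1/2 + m + n) * (m + n))) by (field; lra).
  replace ((1 / 2 + m + n) ^ 2 * (1 / 2 + n) * (1 + m + m + 3 * n) / (2 * (1 + m + 2 * n) ^ 2))
    with (((1/2 + m + n) / (1 + m + 2 * n)) * ((1/2 + m + n) / (1 + m + 2 * n))
      * ((1/2 + n) * (1 + 2 * m + 3 * n) / 2)) by (field; lra).
  set (v := (1/2 + m + n) / (1 + m + 2 * n)) in *.
  apply Rle_trans with (2 * s * s + 1 * (s * s) + 1 * 1 * (s * (3 * s) / 2)).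
  2: { assert (0 <= s) by (unfold s; lra). nra. }
  apply Rabs_add_le; [apply Rabs_add_le|].
  - replace (2 * s * s) with (2 * s * (1 * s)) by ring.
    apply (n_mul_bound n m); [lra|lra|unfold s; lra|]. intros E.
    pose proof (Rdiv_unit (m + n) (2 * m + 3 * n) ltac:(lra) ltac:(lra) ltac:(lra)) as Hu.
    replace ((m + n) ^ 2 / (m + m + 3 * n)) with ((m + n) / (2 * m + 3 * n) * (m + n))
      by (field; lra).
    apply Rabs_mul_le; apply Rabs_le; unfold s; lra.
  - repeat apply Rabs_mul_le; apply Rabs_le; unfold s; lra.
  - unfold Rdiv. repeat apply Rabs_mul_le; try (apply Rabs_le; unfold s; lra).
Qed.

Lemma factorH_bound n m :
  n = 0 \/ 1 <= n -> 0 <= m -> Rabs (factorH m m n) <= 4 * (m + n + 1) ^ 2.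
Proof.
  intros Hn Hm. set (s := m + n + 1).
  unfold factorH.
  pose proof (Rdiv_unit (1/2 + m + n) (1 + 2 * m + n) ltac:(lra) ltac:(lra) ltac:(lra)) as Hz.
  apply Rle_trans with (2 * s * (1 * s + 1 * s)).
  2: { assert (0 <= s) by (unfold s; lra). nra. }
  apply (n_mul_bound n m); [lra|lra|unfold s; lra|]. intros E.
  pose proof (Rdiv_unit (m + n) (2 * m + 3 * n) ltac:(lra) ltac:(lra) ltac:(lra)) as Hu.
  replace ((m + n) ^ 2 / (m + m + 3 * n)) with ((m + n) / (2 * m + 3 * n) * (m + n))
    by (field; lra).
  replace ((1/2 + m + n) ^ 2 / (m + m + n + 1))
    with ((1/2 + m + n) / (1 + 2 * m + n) * (1/2 + m + n)) by (field; lra).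
  apply Rabs_add_le; apply Rabs_mul_le; apply Rabs_le; unfold s; lra.
Qed.

Lemma factorG'_bound n m :
  n = 0 \/ 1 <= n -> 0 <= m -> Rabs (factorG' n m) <= 1400 * (m + n + 1).
Proof.
  intros Hn Hm. set (s := m + n + 1).
  unfold factorG'; cbv zeta.
  pose proof (Rdiv_unit (1/2 + m + n) (1 + m + 2 * n) ltac:(lra) ltac:(lra) ltac:(lra)) as Hv.
  assert (Hy : 0 <= (1 + 2 * m + 3 * n) / (1 + m + 2 * n) <= 2).
  { split; [apply Rdiv_le_0_compat; lra|apply Rle_div_l; lra]. }
  set (v := (1/2 + m + n) / (1 + m + 2 * n)) in *.
  set (y := (1 + 2 * m + 3 * n) / (1 + m + 2 * n)) in *.
  assert (0 <= v ^ 2 <= 1) by nra.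
  assert (Hs : 1 <= s) by (unfold s; destruct Hn; lra).
  apply Rle_trans with
    (2 * s * 199 + (250 * 1 * s + 74 * 1 * s + 125 * 1 * s)
     + s * (/2) * (250 * 1 * 2 + 51 * 1 + 250 * 1 * 2)); [|lra].
  unfold Rminus, Rdiv.
  apply Rabs_add_le; [apply Rabs_add_le|].
  2: repeat apply Rabs_add_le; rewrite ?Rabs_Ropp; repeat apply Rabs_mul_le;
    apply Rabs_le; unfold s; lra.
  2: apply Rabs_mul_le; [apply Rabs_mul_le; apply Rabs_le; unfold s; lra|];
    repeat apply Rabs_add_le; rewrite ?Rabs_Ropp; repeat apply Rabs_mul_le;
    apply Rabs_le; lra.
  apply (n_mul_bound n m); [lra|lra|unfold s; lra|]. intros E.
  pose proof (Rdiv_unit (m + n) (2 * m + 3 * n) ltac:(lra) ltac:(lra) ltac:(lra)) as Hu.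
  fold (Rdiv (m + n) (2 * m + 3 * n)).
  set (u := (m + n) / (2 * m + 3 * n)) in *.
  apply Rabs_le; nra.
Qed.

Lemma factorH'_bound n m :
  n = 0 \/ 1 <= n -> 0 <= m -> Rabs (factorH' n m) <= 1000 * (m + n + 1).
Proof.
  intros Hn Hm. set (s := m + n + 1).
  unfold factorH'; cbv zeta.
  pose proof (Rdiv_unit (1/2 + m + n) (1 + 2 * m + n) ltac:(lra) ltac:(lra) ltac:(lra)) as Hz.
  set (z := (1/2 + m + n) / (1 + 2 * m + n)) in *.
  apply Rle_trans with (2 * s * 500); [|lra].
  apply (n_mul_bound n m); [lra|lra|unfold s; lra|]. intros E.
  pose proof (Rdiv_unit (m + n) (2 * m + 3 * n) ltac:(lra) ltac:(lra) ltac:(lra)) as Hu.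
  set (u := (m + n) / (2 * m + 3 * n)) in *.
  apply Rabs_le; nra.
Qed.

Lemma weight_pos n m : 0 < weight 0 0 n m.
Proof.
  unfold weight, Rdiv.
  repeat first [ apply pow_lt | apply rising_pos; lra
               | apply Rinv_0_lt_compat | apply Rmult_lt_0_compat ].
Qed.

Lemma wzG'_bound n m :
  Rabs (wzG' n m) <= 10000 * weight 0 0 n m * (INR m + INR n + 1) ^ 3.
Proof.
  unfold wzG'. pose proof (weight_pos n m) as Hw.
  pose proof (weight_log_bound n m) as H1.
  pose proof (factorG_bound _ _ (INR_0_or_ge_1 n) (pos_INR m)) as H2.
  pose proof (factorG'_bound _ _ (INR_0_or_ge_1 n) (pos_INR m)) as H3.
  pose proof (pos_INR n); pose proof (pos_INR m).
  set (s := INR m + INR n + 1) in *. assert (1 <= s) by (unfold s; lra).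
  rewrite Rabs_mult, (Rabs_pos_eq (weight 0 0 n m)) by lra.
  apply Rle_trans with (weight 0 0 n m * (1400 * s * (5 * s ^ 2) + 1400 * s)).
  - apply Rmult_le_compat_l; [lra|].
    apply Rabs_add_le; [apply Rabs_mul_le|]; assumption.
  - replace (10000 * weight 0 0 n m * s ^ 3) with (weight 0 0 n m * (10000 * s ^ 3)) by ring.
    apply Rmult_le_compat_l; [lra|].
    assert (1 <= s ^ 2) by nra. nra.
Qed.

Lemma wzH'_bound n m :
  Rabs (wzH' n m) <= 10000 * weight 0 0 n m * (INR m + INR n + 1) ^ 3.
Proof.
  unfold wzH'. pose proof (weight_pos n m) as Hw.
  pose proof (weight_log_bound n m) as H1.
  pose proof (factorH_bound _ _ (INR_0_or_ge_1 n) (pos_INR m)) as H2.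
  pose proof (factorH'_bound _ _ (INR_0_or_ge_1 n) (pos_INR m)) as H3.
  pose proof (pos_INR n); pose proof (pos_INR m).
  set (s := INR m + INR n + 1) in *. assert (1 <= s) by (unfold s; lra).
  rewrite Rabs_mult, (Rabs_pos_eq (weight 0 0 n m)) by lra.
  apply Rle_trans with (weight 0 0 n m * (1400 * s * (4 * s ^ 2) + 1000 * s)).
  - apply Rmult_le_compat_l; [lra|].
    apply Rabs_add_le; [apply Rabs_mul_le|]; assumption.
  - replace (10000 * weight 0 0 n m * s ^ 3) with (weight 0 0 n m * (10000 * s ^ 3)) by ring.
    apply Rmult_le_compat_l; [lra|].
    assert (1 <= s ^ 2) by nra. nra.
Qed.

(** * Decay of the weight *)

Definition wallis (m : nat) : R := rising (1/2) m / rising 1 m.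

Lemma wallis_pos m : 0 < wallis m.
Proof. apply Rdiv_lt_0_compat; apply rising_pos; lra. Qed.

Lemma wallis_succ m : wallis (S m) = wallis m * ((INR m + 1/2) / (INR m + 1)).
Proof.
  unfold wallis; cbn [rising]. pose proof (pos_INR m).
  field. split; [lra|apply Rgt_not_eq, rising_pos; lra].
Qed.

Lemma weight_row0 m : weight 0 0 0 m = wallis m ^ 4.
Proof.
  unfold weight, wallis.
  rewrite !Rplus_0_r, !Nat.mul_0_r, !Nat.add_0_r; simpl (rising _ 0).
  field. split; apply Rgt_not_eq, rising_pos; lra.
Qed.

Lemma wallis_sqr_le m : wallis m ^ 2 * (2 * INR m + 1) <= 1.
Proof.
  induction m as [|m IH].
  - unfold wallis; simpl; lra.
  - rewrite wallis_succ, S_INR. pose proof (pos_INR m). pose proof (wallis_pos m).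
    apply Rle_trans with (2 := IH).
    replace ((wallis m * ((INR m + 1/2) / (INR m + 1))) ^ 2 * (2 * (INR m + 1) + 1))
      with (wallis m ^ 2 * (2 * INR m + 1)
            * ((2 * INR m + 1) * (2 * INR m + 3) / (4 * (INR m + 1) ^ 2)))
      by (field; lra).
    rewrite <- (Rmult_1_r (wallis m ^ 2 * (2 * INR m + 1))) at 2.
    apply Rmult_le_compat_l; [nra|].
    apply Rle_div_l; nra.
Qed.

Lemma weight_row0_le m : weight 0 0 0 m <= (/ (INR m + 1)) ^ 2.
Proof.
  rewrite weight_row0. pose proof (wallis_sqr_le m). pose proof (pos_INR m).
  pose proof (wallis_pos m).
  assert (wallis m ^ 2 <= / (INR m + 1)).
  { apply Rmult_le_reg_r with (INR m + 1); [lra|]. rewrite Rinv_l by lra. nra. }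
  replace (wallis m ^ 4) with ((wallis m ^ 2) ^ 2) by ring.
  apply pow_incr; split; [nra|assumption].
Qed.

(** The ratio splits into the displayed square and five quotients in [0, 1].  Three
    times the square is at most 3/4, which gives geometric decay in [n], and it
    is of order [/ m ^ 2] at [n = 0], which makes the terms with [n > 0]
    negligible against the term [n = 0] as [m] grows. *)
Lemma ratio_n_le m n :
  0 <= m -> 0 <= n -> 0 <= ratio_n m m n <= 3 * ((1/2 + n) / (2 + m + 2 * n)) ^ 2.
Proof.
  intros Hm Hn.
  assert (E : ratio_n m m n = 3 * ((1/2 + n) / (2 + m + 2 * n)) ^ 2
    * (((1/2 + m + n) / (1 + m + n)) ^ 2 * ((1/2 + n) / (1 + n))
       * ((1 + 2 * m + 3 * n) / (2 * (1 + m + 2 * n)))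
       * ((2 + 2 * m + 3 * n) / (2 * (1 + m + 2 * n)))
       * ((3 + 2 * m + 3 * n) / (3 * (1 + 2 * m + n))))).
  { unfold ratio_n. field. repeat split; lra. }
  rewrite E.
  pose proof (Rdiv_unit (1/2 + m + n) (1 + m + n) ltac:(lra) ltac:(lra) ltac:(lra)) as H1.
  pose proof (Rdiv_unit (1/2 + n) (1 + n) ltac:(lra) ltac:(lra) ltac:(lra)) as H2.
  pose proof (Rdiv_unit (1 + 2 * m + 3 * n) (2 * (1 + m + 2 * n))
                ltac:(lra) ltac:(lra) ltac:(lra)) as H3.
  pose proof (Rdiv_unit (2 + 2 * m + 3 * n) (2 * (1 + m + 2 * n))
                ltac:(lra) ltac:(lra) ltac:(lra)) as H4.
  pose proof (Rdiv_unit (3 + 2 * m + 3 * n) (3 * (1 + 2 * m + n))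
                ltac:(lra) ltac:(lra) ltac:(lra)) as H5.
  assert (U : forall x y, 0 <= x <= 1 -> 0 <= y <= 1 -> 0 <= x * y <= 1) by (intros; nra).
  assert (H : forall p, 0 <= p <= 1 ->
    0 <= 3 * ((1/2 + n) / (2 + m + 2 * n)) ^ 2 * p
      <= 3 * ((1/2 + n) / (2 + m + 2 * n)) ^ 2).
  { intros p Hp. pose proof (pow2_ge_0 ((1/2 + n) / (2 + m + 2 * n))). nra. }
  apply H. do 4 (apply U; [|assumption]). simpl pow; rewrite Rmult_1_r; apply U; assumption.
Qed.

Lemma weight_le n m :
  weight 0 0 (S n) m <= (3/4) ^ S n * (/ (INR m + 1)) ^ 4.
Proof.
  pose proof (pos_INR m) as Hm.
  induction n as [|n IH]; rewrite weight_succ_n by lra; rewrite !Rplus_0_l.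
  - pose proof (weight_row0_le m) as H0.
    destruct (ratio_n_le (INR m) (INR 0) Hm (Rle_refl 0)) as [Hr0 Hr].
    pose proof (weight_pos 0 m).
    replace ((3/4) ^ 1 * (/ (INR m + 1)) ^ 4)
      with (3/4 * (/ (INR m + 1)) ^ 2 * (/ (INR m + 1)) ^ 2) by ring.
    apply Rmult_le_compat; [assumption|lra| |assumption].
    apply Rle_trans with (1 := Hr). simpl (INR 0).
    replace (3 * ((1/2 + 0) / (2 + INR m + 2 * 0)) ^ 2)
      with (3/4 * (/ (INR m + 2)) ^ 2) by (field; lra).
    apply Rmult_le_compat_l; [lra|].
    apply pow_incr; split.
    + left; apply Rinv_0_lt_compat; lra.
    + apply Rinv_le_contravar; lra.
  - pose proof (pos_INR (S n)) as Hn.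
    destruct (ratio_n_le (INR m) (INR (S n)) Hm Hn) as [Hr0 Hr].
    pose proof (weight_pos (S n) m).
    replace ((3/4) ^ S (S n) * (/ (INR m + 1)) ^ 4)
      with (3/4 * ((3/4) ^ S n * (/ (INR m + 1)) ^ 4)) by (simpl; ring).
    apply Rmult_le_compat; [assumption|lra| |assumption].
    apply Rle_trans with (1 := Hr).
    assert (0 <= (1/2 + INR (S n)) / (2 + INR m + 2 * INR (S n)) <= 1/2).
    { split; [apply Rdiv_le_0_compat; lra|apply Rle_div_l; lra]. }
    nra.
Qed.

(** Bernoulli's inequality.  The rate 21/20 is chosen so that its cube is below
    7/6 = (7/8) / (3/4): a cubic factor then costs only the passage from the
    rate 3/4 to 7/8. *)
Lemma succ_le_pow n : INR n + 1 <= 20 * (21/20) ^ n.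
Proof.
  pose proof (poly n (1/20) ltac:(lra)). pose proof (pos_INR n).
  replace (1 + 1/20) with (21/20) in H by field. lra.
Qed.

Lemma weight_cube_le n m :
  10000 * weight 0 0 (S n) m * (INR m + INR (S n) + 1) ^ 3
  <= 80000000 * (7/8) ^ S n * / (INR m + 1).
Proof.
  pose proof (pos_INR m) as Hm. pose proof (pos_INR (S n)) as Hn.
  pose proof (weight_le n m) as Hw. pose proof (weight_pos (S n) m) as Hp.
  set (k := S n) in *.
  pose proof (succ_le_pow k) as Hk.
  set (i := / (INR m + 1)) in *.
  assert (Hi : i * (INR m + 1) = 1) by (unfold i; apply Rinv_l; lra).
  assert (0 < i) by (unfold i; apply Rinv_0_lt_compat; lra).
  assert (Hs : (INR m + INR k + 1) ^ 3 <= (INR m + 1) ^ 3 * (8000 * (7/6) ^ k)).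
  { apply Rle_trans with (((INR m + 1) * (20 * (21/20) ^ k)) ^ 3).
    - apply pow_incr; split; [lra|].
      apply Rle_trans with ((INR m + 1) * (INR k + 1)); [nra|].
      apply Rmult_le_compat_l; lra.
    - rewrite !Rpow_mult_distr.
      apply Rmult_le_compat_l; [apply pow_le; lra|].
      replace (20 ^ 3) with 8000 by ring.
      apply Rmult_le_compat_l; [lra|].
      rewrite <- pow_mult, Nat.mul_comm, pow_mult.
      apply pow_incr; lra. }
  apply Rle_trans with (10000 * ((3/4) ^ k * i ^ 4) * ((INR m + 1) ^ 3 * (8000 * (7/6) ^ k))).
  - apply Rmult_le_compat; [lra|apply pow_le; lra|lra|exact Hs].
  - right.
    replace ((7/8) ^ k) with ((3/4) ^ k * (7/6) ^ k)
      by (rewrite <- Rpow_mult_distr; f_equal; field).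
    transitivity (80000000 * ((3/4) ^ k * (7/6) ^ k) * i * (i * (INR m + 1)) ^ 3); [ring|].
    rewrite Hi; ring.
Qed.

(** * Telescoping of the differentiated relation *)

Lemma wzH'_0 m : wzH' 0 m = 0.
Proof. unfold wzH', factorH, factorH'; simpl (INR 0). ring. Qed.

(** Summing [wz_relation'] over [n] telescopes; the lower boundary term vanishes
    because [factorH] has the factor [2 * n]. *)
Lemma sum_wzG'_succ N m :
  sum_n (fun n => wzG' n (S m)) N - sum_n (fun n => wzG' n m) N = wzH' (S N) m.
Proof.
  induction N as [|N IH].
  - rewrite !sum_O, wz_relation', wzH'_0. ring.
  - rewrite !sum_Sn. unfold plus; simpl.
    pose proof (wz_relation' (S N) m). lra.
Qed.

Lemma sum_wzG'_shift N M :
  Rabs (sum_n (fun n => wzG' n M) N - sum_n (fun n => wzG' n 0) N)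
  <= INR M * (80000000 * (7/8) ^ S N).
Proof.
  induction M as [|M IH].
  - rewrite Rminus_diag, Rabs_R0; simpl; lra.
  - rewrite S_INR.
    replace (sum_n (fun n => wzG' n (S M)) N - sum_n (fun n => wzG' n 0) N)
      with (sum_n (fun n => wzG' n M) N - sum_n (fun n => wzG' n 0) N + wzH' (S N) M)
      by (rewrite <- sum_wzG'_succ; ring).
    rewrite Rmult_plus_distr_r, Rmult_1_l.
    apply Rabs_add_le; [exact IH|].
    eapply Rle_trans; [apply wzH'_bound|].
    eapply Rle_trans; [apply weight_cube_le|].
    pose proof (pos_INR M).
    assert (0 < (7/8) ^ S N) by (apply pow_lt; lra).
    assert (/ (INR M + 1) <= 1).
    { rewrite <- Rinv_1. apply Rinv_le_contravar; lra. }
    assert (0 < / (INR M + 1)) by (apply Rinv_0_lt_compat; lra).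
    nra.
Qed.

(** The constant is the partial geometric sum of (7/8)^n for 1 <= n <= N. *)
Lemma sum_wzG'_tail N m :
  Rabs (sum_n (fun n => wzG' n m) N - wzG' 0 m)
  <= 80000000 * (7 - 8 * (7/8) ^ S N) * / (INR m + 1).
Proof.
  induction N as [|N IH].
  - rewrite sum_O, Rminus_diag, Rabs_R0. simpl. lra.
  - rewrite sum_Sn; change plus with Rplus.
    replace (sum_n (fun n => wzG' n m) N + wzG' (S N) m - wzG' 0 m)
      with (sum_n (fun n => wzG' n m) N - wzG' 0 m + wzG' (S N) m) by ring.
    eapply Rle_trans.
    + apply Rabs_add_le; [exact IH|].
      eapply Rle_trans; [apply wzG'_bound|apply weight_cube_le].
    + right. generalize (/ (INR m + 1)); intros i. simpl pow. field.
Qed.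

(** * Wallis' product *)

Definition sin_int (n : nat) : R := RInt (fun x => sin x ^ n) 0 (PI / 2).

Lemma ex_RInt_sin_pow n a b : ex_RInt (fun x => sin x ^ n) a b.
Proof.
  apply (ex_RInt_continuous (V := R_CompleteNormedModule)); intros x _.
  apply (ex_derive_continuous (fun y => sin y ^ n)). auto_derive; exact I.
Qed.

(** Integration by parts: cos x sin^(n+1) x vanishes at both ends of the interval
    and has derivative (n+1) sin^n x - (n+2) sin^(n+2) x. *)
Lemma sin_int_succ2 n : (INR n + 2) * sin_int (S (S n)) = (INR n + 1) * sin_int n.
Proof.
  assert (H : is_RInt (fun x => (INR n + 1) * sin x ^ n - (INR n + 2) * sin x ^ S (S n))
                0 (PI / 2)
                (minus (cos (PI / 2) * sin (PI / 2) ^ S n) (cos 0 * sin 0 ^ S n))).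
  { apply (is_RInt_derive (fun x => cos x * sin x ^ S n)).
    - intros x _. auto_derive; [exact I|].
      replace (match n with O => 1 | S _ => INR n + 1 end) with (INR n + 1)
        by (symmetry; exact (S_INR n)).
      pose proof (sin2_cos2 x) as E. unfold Rsqr in E.
      replace ((INR n + 1) * sin x ^ n - (INR n + 2) * sin x ^ S (S n))
        with (sin x ^ n * ((INR n + 1) - (INR n + 2) * (sin x * sin x))) by (simpl; ring).
      replace (sin x * sin x) with (1 - cos x * cos x) by lra.
      transitivity (sin x ^ n * (- (sin x * sin x) + (INR n + 1) * (cos x * cos x)));
        [simpl; ring|].
      replace (sin x * sin x) with (1 - cos x * cos x) by lra. ring.
    - intros x _.
      apply (ex_derive_continuous
        (fun x => (INR n + 1) * sin x ^ n - (INR n + 2) * sin x ^ S (S n))).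
      auto_derive; repeat split. }
  rewrite cos_PI2, sin_0 in H.
  assert (H' : is_RInt (fun x => (INR n + 1) * sin x ^ n - (INR n + 2) * sin x ^ S (S n))
                0 (PI / 2) ((INR n + 1) * sin_int n - (INR n + 2) * sin_int (S (S n)))).
  { apply (is_RInt_minus (V := R_NormedModule)
             (fun x => (INR n + 1) * sin x ^ n) (fun x => (INR n + 2) * sin x ^ S (S n)));
    apply (is_RInt_scal (V := R_NormedModule)); apply (RInt_correct (V := R_CompleteNormedModule));
    apply ex_RInt_sin_pow. }
  apply (is_RInt_unique (V := R_CompleteNormedModule)) in H.
  apply (is_RInt_unique (V := R_CompleteNormedModule)) in H'.
  rewrite H in H'. unfold minus, plus, opp in H'; simpl in H'. lra.
Qed.

Lemma sin_int_decr n : sin_int (S n) <= sin_int n.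
Proof.
  pose proof PI_RGT_0.
  apply RInt_le; [lra|apply ex_RInt_sin_pow|apply ex_RInt_sin_pow|].
  intros x Hx. simpl.
  assert (0 <= sin x) by (apply sin_ge_0; lra).
  pose proof (SIN_bound x). pose proof (pow_le _ n H0).
  nra.
Qed.

Lemma sin_int_even m : sin_int (2 * m) = PI / 2 * wallis m.
Proof.
  induction m as [|m IH].
  - unfold sin_int, wallis; simpl. rewrite RInt_const.
    unfold scal; simpl; unfold mult; simpl. field.
  - replace (2 * S m)%nat with (S (S (2 * m))) by lia.
    pose proof (sin_int_succ2 (2 * m)) as H. rewrite IH, mult_INR in H.
    change (INR 2) with 2 in H. rewrite wallis_succ. pose proof (pos_INR m).
    apply (Rmult_eq_reg_l (2 * INR m + 2)); [|lra].
    rewrite H. field. lra.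
Qed.

Lemma sin_int_odd m : sin_int (S (2 * m)) = / ((2 * INR m + 1) * wallis m).
Proof.
  induction m as [|m IH].
  - unfold wallis; simpl.
    replace (/ ((2 * 0 + 1) * (1 / 1))) with (minus (- cos (PI / 2)) (- cos 0)).
    2: { rewrite cos_PI2, cos_0. unfold minus, plus, opp; simpl. field. }
    apply is_RInt_unique.
    apply (is_RInt_ext sin); [intros; simpl; ring|].
    apply (is_RInt_derive (fun x => - cos x)).
    + intros x _. auto_derive; [exact I|ring].
    + intros x _. apply (ex_derive_continuous sin). auto_derive; exact I.
  - replace (S (2 * S m)) with (S (S (S (2 * m)))) by lia.
    pose proof (sin_int_succ2 (S (2 * m))) as H. rewrite IH, !S_INR, mult_INR in H.
    change (INR 2) with 2 in H. rewrite wallis_succ, S_INR.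
    pose proof (pos_INR m). pose proof (wallis_pos m).
    apply (Rmult_eq_reg_l (2 * INR m + 1 + 2)); [|lra].
    rewrite H. field. lra.
Qed.

(** Even and odd sine integrals are PI / 2 times [wallis] and the inverse of
    [(2 * m + 1) * wallis m]; their monotonicity squeezes the square of [wallis],
    the two bounds coming from consecutive pairs on either side of
    [2 * m + 1]. *)
Lemma wallis_bounds m :
  2 / PI <= wallis m ^ 2 * (2 * INR m + 1) <= 2 / PI * (1 + / (INR m + 1)).
Proof.
  pose proof PI_RGT_0 as HP. pose proof (pos_INR m). pose proof (wallis_pos m) as Hw.
  assert (Hd : 0 < (2 * INR m + 1) * wallis m) by nra.
  pose proof (Rmult_lt_0_compat _ _ HP Hw).
  split.
  - pose proof (sin_int_decr (2 * m)) as D. rewrite sin_int_even, sin_int_odd in D.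
    apply (Rmult_le_compat_r _ _ _ (Rlt_le _ _ Hd)) in D.
    rewrite Rinv_l in D by lra.
    apply Rle_div_l; [lra|]. nra.
  - pose proof (sin_int_decr (S (2 * m))) as D.
    replace (S (S (2 * m))) with (2 * S m)%nat in D by lia.
    rewrite sin_int_even, sin_int_odd, wallis_succ in D.
    apply (Rmult_le_compat_r _ _ _ (Rlt_le _ _ Hd)) in D.
    rewrite Rinv_l in D by lra.
    apply (Rmult_le_reg_l (PI / 2 * ((INR m + 1/2) / (INR m + 1)))).
    { apply Rmult_lt_0_compat; [lra|apply Rdiv_lt_0_compat; lra]. }
    apply Rle_trans with 1; [lra|].
    apply Rle_trans with ((INR m + 1/2) * (INR m + 2) / (INR m + 1) ^ 2).
    + apply Rle_div_r; nra.
    + right. field. lra.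
Qed.

Lemma is_lim_seq_of_rate (f : nat -> R) (l K : R) :
  (forall m, Rabs (f m - l) <= K * / (INR m + 1)) -> is_lim_seq f l.
Proof.
  intros H.
  assert (Hi : is_lim_seq (fun m => K * / (INR m + 1)) 0).
  { replace (Finite 0) with (Rbar_mult K 0) by (simpl; f_equal; ring).
    apply is_lim_seq_scal_l.
    apply (is_lim_seq_ext (fun m => / INR (S m))); [intros; now rewrite S_INR|].
    apply (is_lim_seq_inv _ p_infty); [|discriminate].
    apply (is_lim_seq_incr_1 INR), is_lim_seq_INR. }
  apply (is_lim_seq_le_le (fun m => l - K * / (INR m + 1)) f (fun m => l + K * / (INR m + 1))).
  - intros m. pose proof (Rabs_le_between' (f m) l (K * / (INR m + 1))) as E.
    apply E, H.
  - replace (Finite l) with (Finite (l - 0)) by (f_equal; ring).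
    apply is_lim_seq_minus'; [apply is_lim_seq_const|exact Hi].
  - replace (Finite l) with (Finite (l + 0)) by (f_equal; ring).
    apply is_lim_seq_plus'; [apply is_lim_seq_const|exact Hi].
Qed.

(** * Harmonic sums and the logarithm of 2 *)

Lemma ln_le_pred y : 0 < y -> ln y <= y - 1.
Proof.
  intros Hy. pose proof (exp_ineq1_le (ln y)) as H. rewrite exp_ln in H; lra.
Qed.

(** Comparison of each 1 / (j + 1) with the increments of [ln] on [j, j + 1]
    and on [j + 1, j + 2]. *)
Lemma recip_sum_block m k :
  (1 <= m)%nat ->
  ln (INR (m + k) + 1) - ln (INR m + 1)
  <= recip_sum 1 (m + k) - recip_sum 1 m <= ln (INR (m + k)) - ln (INR m).
Proof.
  intros Hm. induction k as [|k IH].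
  - rewrite Nat.add_0_r. lra.
  - rewrite Nat.add_succ_r. cbn [recip_sum]. rewrite S_INR.
    assert (1 <= INR (m + k)) by (apply (le_INR 1); lia).
    set (j := INR (m + k)) in *.
    pose proof (ln_le_pred ((j + 1 + 1) / (j + 1)) ltac:(apply Rdiv_lt_0_compat; lra)) as H1.
    pose proof (ln_le_pred (j / (j + 1)) ltac:(apply Rdiv_lt_0_compat; lra)) as H2.
    rewrite ln_div in H1, H2 by lra.
    replace ((j + 1 + 1) / (j + 1) - 1) with (/ (1 + j)) in H1 by (field; lra).
    replace (j / (j + 1) - 1) with (- / (1 + j)) in H2 by (field; lra).
    lra.
Qed.

Lemma recip_sum_double_lim :
  is_lim_seq (fun m => recip_sum 1 (2 * m) - recip_sum 1 m) (ln 2).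
Proof.
  apply is_lim_seq_of_rate with 1. intros m.
  destruct m as [|m].
  - simpl. pose proof ln_lt_2. pose proof (ln_le_pred 2 ltac:(lra)).
    apply Rabs_le. lra.
  - set (p := S m).
    assert (Hp : 1 <= INR p) by (apply (le_INR 1); unfold p; lia).
    pose proof (recip_sum_block p p ltac:(unfold p; lia)) as H.
    replace (p + p)%nat with (2 * p)%nat in H by lia.
    rewrite mult_INR in H. change (INR 2) with 2 in H.
    rewrite ln_mult in H by lra.
    pose proof (ln_le_pred (2 * (INR p + 1) / (2 * INR p + 1))
                  ltac:(apply Rdiv_lt_0_compat; lra)) as H1.
    rewrite ln_div, ln_mult in H1 by lra.
    replace (2 * (INR p + 1) / (2 * INR p + 1) - 1) with (/ (2 * INR p + 1)) in H1
      by (field; lra).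
    assert (/ (2 * INR p + 1) <= / (INR p + 1)) by (apply Rinv_le_contravar; lra).
    assert (0 < / (2 * INR p + 1)) by (apply Rinv_0_lt_compat; lra).
    apply Rabs_le. lra.
Qed.

(** * The surviving term and the sum of the derivatives *)

Lemma recip_sum_half k :
  recip_sum (1/2) k = 2 * recip_sum 1 (2 * k) - recip_sum 1 k.
Proof.
  induction k as [|k IH]; [simpl; ring|].
  replace (2 * S k)%nat with (S (S (2 * k))) by lia.
  cbn [recip_sum]. rewrite IH, S_INR, mult_INR. change (INR 2) with 2.
  pose proof (pos_INR k). field. lra.
Qed.

(** At [n = 0] the logarithmic derivative of the weight is
    204 (H_{2m} - H_m), and the weight is [wallis m ^ 4], of order [/ m ^ 2].
    Against it [factorG] is of order [m ^ 2] and contributes the limit, while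
    [factorG'] is only of order [m] and disappears. *)
Lemma wzG'_row0_lim : is_lim_seq (wzG' 0) (204 * ln 2 / PI ^ 2).
Proof.
  pose proof PI_RGT_0 as HP.
  set (q := fun m => wallis m ^ 2 * (2 * INR m + 1)).
  set (r := fun m => (4 * INR m ^ 2 + 6 * INR m + 1) / (16 * (INR m + 1) ^ 2)).
  set (d := fun m => recip_sum 1 (2 * m) - recip_sum 1 m).
  set (e := fun m => wallis m ^ 4 * factorG' 0 (INR m)).
  apply (is_lim_seq_ext (fun m => q m * q m * r m * (204 * d m) + e m)).
  { intros m. unfold wzG', q, r, d, e. rewrite weight_row0.
    unfold weight_log. rewrite !Nat.mul_0_r, !Nat.add_0_r, recip_sum_half.
    unfold factorG. simpl (INR 0). rewrite Rmult_0_r, Rmult_0_l.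
    pose proof (pos_INR m). field. lra. }
  assert (Hq : is_lim_seq q (2 / PI)).
  { apply is_lim_seq_of_rate with (2 / PI). intros m. unfold q.
    pose proof (wallis_bounds m). apply Rabs_le. lra. }
  assert (Hr : is_lim_seq r (1/4)).
  { apply is_lim_seq_of_rate with 1. intros m. unfold r.
    pose proof (pos_INR m).
    replace ((4 * INR m ^ 2 + 6 * INR m + 1) / (16 * (INR m + 1) ^ 2) - 1 / 4)
      with (- ((2 * INR m + 3) / (16 * (INR m + 1))) * / (INR m + 1)) by (field; lra).
    assert (0 < / (INR m + 1)) by (apply Rinv_0_lt_compat; lra).
    pose proof (Rdiv_unit (2 * INR m + 3) (16 * (INR m + 1)) ltac:(lra) ltac:(lra) ltac:(lra)).
    apply Rabs_mul_le; apply Rabs_le; lra. }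
  assert (He : is_lim_seq e 0).
  { apply is_lim_seq_of_rate with 1400. intros m. unfold e.
    pose proof (weight_row0_le m) as Hw. rewrite weight_row0 in Hw.
    pose proof (pos_INR m). pose proof (wallis_pos m).
    pose proof (factorG'_bound 0 (INR m) (or_introl eq_refl) (pos_INR m)) as Hb.
    rewrite Rplus_0_r in Hb. rewrite Rminus_0_r.
    replace (1400 * / (INR m + 1)) with ((/ (INR m + 1)) ^ 2 * (1400 * (INR m + 1)))
      by (field; lra).
    apply Rabs_mul_le; [|assumption].
    rewrite Rabs_pos_eq; [assumption|]. apply pow_le; lra. }
  replace (Finite (204 * ln 2 / PI ^ 2))
    with (Finite (2 / PI * (2 / PI) * (1/4) * (204 * ln 2) + 0))
    by (f_equal; field; lra).
  apply is_lim_seq_plus'; [|exact He].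
  apply is_lim_seq_mult'.
  - apply is_lim_seq_mult'; [apply is_lim_seq_mult'; exact Hq|exact Hr].
  - apply (is_lim_seq_scal_l _ 204 (ln 2)), recip_sum_double_lim.
Qed.

Lemma mul_geom_lim : is_lim_seq (fun N => INR N * (7/8) ^ S N) 0.
Proof.
  apply (is_lim_seq_le_le (fun _ => 0) _ (fun N => 20 * (147/160) ^ N)).
  - intros N. pose proof (succ_le_pow N). pose proof (pos_INR N).
    assert (Hp : 0 < (7/8) ^ N) by (apply pow_lt; lra).
    replace (147/160) with (21/20 * (7/8)) by field. rewrite Rpow_mult_distr.
    simpl pow. split; [apply Rmult_le_pos; lra|].
    apply Rle_trans with (INR N * (7/8) ^ N); [nra|].
    rewrite <- Rmult_assoc. apply Rmult_le_compat_r; lra.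
  - apply is_lim_seq_const.
  - replace (Finite 0) with (Rbar_mult 20 0) by (simpl; f_equal; ring).
    apply is_lim_seq_scal_l, is_lim_seq_geom. rewrite Rabs_pos_eq; lra.
Qed.

(** With the shift [m = N] equal to the last index of the partial sum, both errors
    vanish together: replacing [wzG' n 0] by [wzG' n N] costs
    [N * O((7/8) ^ N)], and keeping only [n = 0] costs [O(1 / N)]. *)
Lemma is_series_wzG' : is_series (fun n => wzG' n 0) (204 * ln 2 / PI ^ 2).
Proof.
  set (K := 80000000).
  change (is_lim_seq (sum_n (fun n => wzG' n 0)) (204 * ln 2 / PI ^ 2)).
  set (err := fun N => sum_n (fun n => wzG' n 0) N - wzG' 0 N).
  apply (is_lim_seq_ext (fun N => wzG' 0 N + err N)); [intros; unfold err; R_eq; ring|].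
  replace (Finite (204 * ln 2 / PI ^ 2)) with (Finite (204 * ln 2 / PI ^ 2 + 0))
    by (f_equal; ring).
  apply is_lim_seq_plus'; [exact wzG'_row0_lim|].
  set (tail := fun N => sum_n (fun n => wzG' n N) N - wzG' 0 N).
  apply (is_lim_seq_ext (fun N => tail N + (err N - tail N))); [intros; R_eq; ring|].
  replace (Finite 0) with (Finite (0 + 0)) by (f_equal; ring).
  apply is_lim_seq_plus'.
  - apply is_lim_seq_of_rate with (7 * K). intros N. rewrite Rminus_0_r.
    eapply Rle_trans; [apply sum_wzG'_tail|].
    pose proof (pos_INR N).
    assert (0 < / (INR N + 1)) by (apply Rinv_0_lt_compat; lra).
    assert (0 < (7/8) ^ S N) by (apply pow_lt; lra).
    fold K. apply Rmult_le_compat_r; [lra|]. unfold K; lra.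
  - apply is_lim_seq_abs_0.
    apply (is_lim_seq_le_le (fun _ => 0) _ (fun N => K * (INR N * (7/8) ^ S N))).
    + intros N. split; [apply Rabs_pos|]. unfold err, tail.
      rewrite <- Rabs_Ropp.
      match goal with |- Rabs ?x <= _ =>
        replace x with (sum_n (fun n => wzG' n N) N - sum_n (fun n => wzG' n 0) N) by ring
      end.
      eapply Rle_trans; [apply sum_wzG'_shift|]. unfold K; lra.
    + apply is_lim_seq_const.
    + replace (Finite 0) with (Rbar_mult K 0) by (simpl; f_equal; ring).
      apply is_lim_seq_scal_l, mul_geom_lim.
Qed.

(** * Translation into binomials and harmonic numbers *)

Lemma rising_1_fact k : rising 1 k = INR (fact k).
Proof.
  induction k as [|k IH]; [reflexivity|].
  cbn [rising]. rewrite IH, fact_simpl, mult_INR, S_INR. ring.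
Qed.

Lemma rising_half_fact k :
  rising (1/2) k = INR (fact (2 * k)) / (4 ^ k * INR (fact k)).
Proof.
  induction k as [|k IH]; [simpl; field|].
  replace (2 * S k)%nat with (S (S (2 * k))) by lia.
  cbn [rising pow]. rewrite IH, !fact_simpl, !mult_INR, !S_INR, mult_INR.
  change (INR 2) with 2.
  pose proof (pos_INR k). pose proof (INR_fact_neq_0 k).
  pose proof (pow_nonzero 4 k ltac:(lra)).
  field. repeat split; try assumption; lra.
Qed.

Lemma recip_sum_harmonic k : recip_sum 1 k = harmonic k.
Proof.
  unfold harmonic. induction k as [|k IH].
  - rewrite sum_n_m_zero by lia. reflexivity.
  - rewrite sum_n_Sm by lia. rewrite <- IH. cbn [recip_sum].
    rewrite S_INR, (Rplus_comm 1). reflexivity.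
Qed.

Lemma weight_col0 k :
  weight 0 0 k 0
  = Binomial.C (2 * k) k ^ 4 * Binomial.C (3 * k) k / 2 ^ (12 * k).
Proof.
  unfold weight, Binomial.C.
  replace (2 * k - k)%nat with k by lia. replace (3 * k - k)%nat with (2 * k)%nat by lia.
  rewrite !Rplus_0_r, !Nat.mul_0_r, !Nat.add_0_l; simpl (rising _ 0).
  rewrite !rising_1_fact, !rising_half_fact.
  replace (2 ^ (12 * k)) with ((4 ^ k) ^ 6)
    by (rewrite <- pow_mult, Nat.mul_comm, pow_mult, (pow_mult 2); f_equal; ring).
  pose proof (INR_fact_neq_0 k). pose proof (INR_fact_neq_0 (2 * k)).
  pose proof (pow_nonzero 4 k ltac:(lra)).
  field. repeat split; assumption.
Qed.

(** The linear terms of [factorG'] cancel along the chosen line: its value at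
    [m = 0] is (250 / 3 * 51 - 34 * 125) n + 15 * 51 - 6 * 125 over 48, which
    is the constant 15 / 48. *)
Lemma summand_eq k :
  48 * wzG' k 0
  = Binomial.C (2 * k) k ^ 4 * Binomial.C (3 * k) k / 2 ^ (12 * k) *
    ((74 * INR k ^ 2 + 27 * INR k + 3) *
     (51 * harmonic (3 * k) + 250 * harmonic (2 * k) - 153 * harmonic k) + 15).
Proof.
  rewrite <- weight_col0. unfold wzG'.
  assert (Hb : factorG (INR 0) (INR 0) (INR k) = (74 * INR k ^ 2 + 27 * INR k + 3) / 48).
  { unfold factorG. simpl (INR 0).
    destruct (INR_0_or_ge_1 k) as [-> | Hk].
    - rewrite !Rmult_0_r, !Rmult_0_l. field.
    - field. lra. }
  assert (Hb' : factorG' (INR k) (INR 0) = 15 / 48).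
  { unfold factorG'. simpl (INR 0). cbv zeta.
    destruct (INR_0_or_ge_1 k) as [-> | Hk].
    - rewrite !Rmult_0_r, !Rmult_0_l. field.
    - field. lra. }
  rewrite Hb, Hb'. unfold weight_log.
  rewrite !Nat.mul_0_r, !Nat.add_0_l, recip_sum_half, !recip_sum_harmonic.
  change (recip_sum (1/2) 0) with 0. field.
Qed.

Theorem theorem1p10 :
  is_series
    (fun k : nat =>
       Binomial.C (2 * k) k ^ 4 * Binomial.C (3 * k) k / 2 ^ (12 * k) *
       ((74 * INR k ^ 2 + 27 * INR k + 3) *
        (51 * harmonic (3 * k) + 250 * harmonic (2 * k) - 153 * harmonic k)
        + 15))
    (9792 * ln 2 / PI ^ 2).
Proof.
  apply (is_series_ext (fun k => 48 * wzG' k 0)); [exact summand_eq|].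
  replace (9792 * ln 2 / PI ^ 2) with (48 * (204 * ln 2 / PI ^ 2))
    by (field; apply PI_neq0).
  exact (is_series_scal 48 _ _ is_series_wzG').
Qed.
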